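(* Let $(\alpha,\beta)\subset\mathbb{R}$ be a bounded interval and let $W$ be a convex potential defined on $(\alpha,\beta)$. Let $v_1$ be a positive solution of $$\begin{cases}-v_1''(s)+W(s)v_1(s)=\mu_1v_1(s)\quad\text{in }(\alpha,\beta),\\ v_1(\alpha)=v_1(\beta)=0,\\ v_1\ge0,\quad\max v_1=1,\end{cases}$$ where $\mu_1$ is the first eigenvalue. Then $$\int_\alpha^\beta v_1(s)\,ds\ \le\ \frac{2}{\pi}(\beta-\alpha).$$
   Context: ''Convex potential'' means that $W:(\alpha,\beta)\to\mathbb{R}$ is a convex function. $\mu_1$ denotes the first eigenvalue of the one-dimensional Schrödinger operator $-\frac{d^2}{ds^2}+W$ on $(\alpha,\beta)$ with homogeneous Dirichlet boundary conditions. *)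

(* Defs.v *)
(* Stdlib reals with Coquelicot. *)
From Stdlib Require Export Reals.
From Coquelicot Require Export Coquelicot.

Open Scope R_scope.

Definition convex_on_interval (a b : R) (W : R -> R) : Prop :=
  forall x y t : R, a < x < b -> a < y < b -> 0 <= t <= 1 ->
    W ((1 - t) * x + t * y) <= (1 - t) * W x + t * W y.

(* Only the values of W on the open interval (a,b) matter; W need not be bounded
   near a or b.  A solution is classical: twice differentiable in (a,b) and
   continuous up to the boundary.  [ex_derive v s] is required separately because
   [Derive v] is a total function, so [ex_derive_n v 2 s] alone does not say that
   v itself is differentiable. *)
Definition dirichlet_solution (a b : R) (W : R -> R) (lam : R) (v : R -> R) : Prop :=
  continuous_on (fun s : R => a <= s <= b) v /\
  (forall s : R, a < s < b ->
     ex_derive v s /\ ex_derive_n v 2 s /\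
     - Derive_n v 2 s + W s * v s = lam * v s) /\
  v a = 0 /\ v b = 0.

Definition dirichlet_eigenvalue (a b : R) (W : R -> R) (lam : R) : Prop :=
  exists u : R -> R,
    dirichlet_solution a b W lam u /\ exists s : R, a < s < b /\ u s <> 0.

Definition first_dirichlet_eigenvalue (a b : R) (W : R -> R) (mu : R) : Prop :=
  dirichlet_eigenvalue a b W mu /\
  forall lam : R, dirichlet_eigenvalue a b W lam -> mu <= lam.

Definition is_max_on (a b : R) (v : R -> R) (m : R) : Prop :=
  (exists s : R, a <= s <= b /\ v s = m) /\ forall s : R, a <= s <= b -> v s <= m.

(* Main.v *)
Require Import Defs.
From Stdlib Require Import Reals Lra Classical_Prop.
From Coquelicot Require Import Coquelicot.

Open Scope R_scope.

(** Write [v'' = q v] with [q = W - mu1] convex, and let [m] be the point where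
    [v = 1].  Then [q m < 0], since otherwise [q >= 0] on one side of [m] and [v]
    would not decrease there ([potential_neg_at_top]); and [v] is strictly
    monotone on each side ([half_wave_slope_neg]).  So each side can be
    parametrised by the angle [t] in [[0, pi/2]] with [v = cos t]: let [y_1 t] and
    [y_2 t] be the distances from [m] to the two points at height [cos t], and
    [p_1 t], [p_2 t] the values of [|v'|] there.  The length of the level set is
    [D = y_1 + y_2], with [D 0 = 0] and [D (pi/2) = l = beta - alpha].

    The heart of the matter is that [D] is convex, so that [D t <= (2/pi) l t]:
    every level set is at most as long as that of the sine arch on an interval of
    length [l] ([level_length_bound]).  Integrating this against [sin t] bounds
    the integral of [v] by [(2/pi) l] ([two_half_waves_integral]).

    For the convexity, [y_i' = sin t / p_i], and with [q_i] the value of [q] at the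
    level point,
    [[
      (p_i^2)' = - 2 sin t cos t q_i,
      (sin t / p_i)' = cos t (p_i^2 + sin^2 t q_i) / p_i^3 = cos t A_i / p_i^3.
    ]]
    When [q] is constant, [A_i = 0].  In general [A_i / sin^2 t] compares [q_i] at
    [t] with its weighted average over [[0, t]].  Up to a reflection, [q] increases
    to the right of [m].  Then [A_2 >= 0].  Convexity of [q] makes [q_1 + q_2]
    increase with [t] ([potential_sum_increasing]), hence [A_1 + A_2 >= 0].
    Finally [A_1 < 0] forces [q_1] to stay below [q m], so that the left side is
    the steeper one and [A_2] has the larger weight [p_2^-3]; thus [D'' >= 0]
    ([speed_derivative_nonneg]). *)

(** * Derivatives of inverse functions *)

Lemma is_derive_continuity (f : R -> R) (x l : R) :
  is_derive f x l -> continuity_pt f x.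
Proof.
  intros H. apply continuity_pt_filterlim.
  apply (ex_derive_continuous (K := R_AbsRing) (V := R_NormedModule)).
  now exists l.
Qed.


Lemma mean_value (f df : R -> R) (a b : R) :
  a < b ->
  (forall x, a <= x <= b -> continuity_pt f x) ->
  (forall x, a < x < b -> is_derive f x (df x)) ->
  exists c, a < c < b /\ f b - f a = df c * (b - a).
Proof.
  intros hab hc hd.
  assert (pr : forall c, a < c < b -> derivable_pt f c).
  { intros c h. exists (df c). now apply is_derive_Reals, hd. }
  destruct (MVT f id a b pr (fun c _ => derivable_pt_id c) hab hc) as [c [P E]].
  { intros c _. apply derivable_continuous_pt, derivable_pt_id. }
  exists c. split; [exact P |].
  rewrite derive_pt_id in E. unfold id in E.
  rewrite (derive_pt_eq_0 f c (df c) (pr c P)) in E.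
  - lra.
  - now apply is_derive_Reals, hd.
Qed.

Lemma derive_nonneg_le (f df : R -> R) (a b : R) :
  a <= b ->
  (forall x, a <= x <= b -> continuity_pt f x) ->
  (forall x, a < x < b -> is_derive f x (df x)) ->
  (forall x, a < x < b -> 0 <= df x) ->
  f a <= f b.
Proof.
  intros [hab | ->] hc hd hp; [| lra].
  destruct (mean_value f df a b hab hc hd) as [c [hin E]].
  assert (h := hp c hin). nra.
Qed.

Lemma derive_neg_lt (f df : R -> R) (a b : R) :
  a < b ->
  (forall x, a <= x <= b -> continuity_pt f x) ->
  (forall x, a < x < b -> is_derive f x (df x)) ->
  (forall x, a < x < b -> df x < 0) ->
  f b < f a.
Proof.
  intros hab hc hd hp.
  destruct (mean_value f df a b hab hc hd) as [c [hin E]].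
  assert (h := hp c hin). nra.
Qed.

(** The slope of the chord from [x] to [z], completed by the value [l] at
    [z = x]: differentiability becomes continuity of this quotient, which turns
    the derivative of an inverse function into a quotient of continuous
    functions. *)
Definition slope (f : R -> R) (x l z : R) : R :=
  if Req_EM_T z x then l else (f z - f x) / (z - x).

Lemma slope_spec (f : R -> R) (x l z : R) : f z - f x = slope f x l z * (z - x).
Proof.
  unfold slope. destruct (Req_EM_T z x) as [-> | hne]; [ring | field; lra].
Qed.

Lemma slope_at (f : R -> R) (x l : R) : slope f x l x = l.
Proof. unfold slope. destruct (Req_EM_T x x); [reflexivity | lra]. Qed.

Lemma is_derive_slope (f : R -> R) (x l : R) :
  is_derive f x l <-> continuity_pt (slope f x l) x.
Proof.
  rewrite is_derive_Reals, continuity_pt_locally, slope_at. split.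
  - intros H eps. destruct (H eps (cond_pos eps)) as [d Hd].
    exists d. intros z hz. change R in z. change (Rabs (z - x) < d) in hz. unfold slope.
    destruct (Req_EM_T z x) as [-> | hne].
    + replace (l - l) with 0 by ring. rewrite Rabs_R0. apply cond_pos.
    + assert (h := Hd (z - x) ltac:(lra) hz).
      now replace (x + (z - x)) with z in h by lra.
  - intros H eps heps. destruct (H (mkposreal eps heps)) as [d Hd].
    exists d. intros h hne hh.
    assert (hb : ball x d (x + h)).
    { assert (e : x + h - x = h) by ring.
      change (Rabs (x + h - x) < d). now rewrite e. }
    assert (k := Hd (x + h) hb). simpl in k. unfold slope in k.
    destruct (Req_EM_T (x + h) x); [lra |].
    now replace (x + h - x) with h in k by ring.
Qed.

(** Implicit differentiation of [f (y t) = g t], for [y] merely continuous. *)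
Lemma is_derive_implicit (f y g : R -> R) (x l m : R) :
  locally x (fun t => f (y t) = g t) ->
  continuity_pt y x ->
  is_derive f (y x) l -> l <> 0 ->
  is_derive g x m ->
  is_derive y x (m / l).
Proof.
  intros heq hy hf hl hg.
  apply is_derive_slope in hf. apply is_derive_slope in hg. apply is_derive_slope.
  assert (hfy : continuity_pt (fun t => slope f (y x) l (y t)) x)
    by exact (continuity_pt_comp y (slope f (y x) l) x hy hf).
  assert (hnz : locally x (fun t => slope f (y x) l (y t) <> 0)).
  { assert (hl' : 0 < Rabs l) by now apply Rabs_pos_lt.
    apply (filter_imp (F := locally x)
             (fun t => Rabs (slope f (y x) l (y t) - slope f (y x) l (y x)) < Rabs l)).
    - intros t ht h0. rewrite h0, slope_at in ht.
      replace (0 - l) with (- l) in ht by ring. rewrite Rabs_Ropp in ht. lra.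
    - exact (proj1 (continuity_pt_locally _ _) hfy (mkposreal _ hl')). }
  apply (continuity_pt_ext_loc
           (fun t => slope g x m t / slope f (y x) l (y t))).
  - assert (hx := locally_singleton _ _ heq). cbv beta in hx.
    apply (filter_imp (F := locally x) (fun t => f (y t) = g t /\ slope f (y x) l (y t) <> 0)).
    2: now apply filter_and.
    intros t [et nt]. unfold slope at 3.
    destruct (Req_EM_T t x) as [-> | hne].
    + now rewrite !slope_at.
    + assert (e1 := slope_spec g x m t).
      assert (e2 := slope_spec f (y x) l (y t)).
      rewrite et, hx, e1 in e2.
      apply (Rmult_eq_reg_r (slope f (y x) l (y t) * (t - x))).
      2: { apply Rmult_integral_contrapositive; split; [exact nt | lra]. }
      field_simplify; [lra | lra | exact nt].
  - apply continuity_pt_div; [exact hg | exact hfy |].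
    now rewrite slope_at.
Qed.

Definition clamp (a b x : R) : R := Rmax a (Rmin b x).

Lemma clamp_in (a b x : R) : a <= b -> a <= clamp a b x <= b.
Proof. intros h. unfold clamp, Rmax, Rmin. repeat destruct Rle_dec; lra. Qed.

Lemma clamp_id (a b x : R) : a <= x <= b -> clamp a b x = x.
Proof. intros h. unfold clamp, Rmax, Rmin. repeat destruct Rle_dec; lra. Qed.

Lemma clamp_lipschitz (a b x y : R) : Rabs (clamp a b x - clamp a b y) <= Rabs (x - y).
Proof.
  unfold clamp, Rmax, Rmin, Rabs.
  repeat destruct Rle_dec; repeat destruct Rcase_abs; lra.
Qed.

Lemma clamp_continuity (a b : R) : continuity (clamp a b).
Proof.
  intros x. apply continuity_pt_locally. intros eps. exists eps. intros z hz.
  apply Rle_lt_trans with (1 := clamp_lipschitz a b z x). exact hz.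
Qed.

(** Extending a function by its boundary values makes it continuous on the whole
    line, so that two-sided continuity can be used at the endpoints as well. *)
Lemma continuous_on_clamp (a b : R) (f : R -> R) :
  a <= b -> continuous_on (fun s => a <= s <= b) f ->
  continuity (fun s => f (clamp a b s)).
Proof.
  intros hab hf x. apply continuity_pt_filterlim.
  apply (filterlim_comp _ _ _ (clamp a b) f _
           (within (fun s => a <= s <= b) (locally (clamp a b x)))).
  2: { apply hf. now apply clamp_in. }
  intros P [d Hd]. exists d. intros z hz.
  apply Hd.
  - apply Rle_lt_trans with (1 := clamp_lipschitz a b z x). exact hz.
  - now apply clamp_in.
Qed.

(** A strictly monotone function cannot jump over values, so an inverse of it
    composed with a continuous function is continuous. *)
Lemma decreasing_inverse_continuity (f y g : R -> R) (b : R) :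
  (forall r s, 0 <= r -> r < s -> s <= b -> f s < f r) ->
  (forall t, 0 <= y t <= b) ->
  (forall t, f (y t) = g t) ->
  continuity g -> continuity y.
Proof.
  intros hf hy heq hg x. apply continuity_pt_locally. intros eps.
  assert (he := cond_pos eps). assert (hx := hy x).
  assert (up : locally x (fun t => y t < y x + eps)).
  { destruct (Rle_lt_dec (y x + eps) b) as [h | h].
    - assert (k : 0 < g x - f (y x + eps)).
      { assert (f (y x + eps) < f (y x)) by (apply hf; lra). rewrite <- heq. lra. }
      apply (filter_imp (F := locally x) (fun t => Rabs (g t - g x) < g x - f (y x + eps))).
      2: exact (proj1 (continuity_pt_locally _ _) (hg x) (mkposreal _ k)).
      intros t ht. apply Rabs_def2 in ht.
      destruct (Rlt_le_dec (y t) (y x + eps)) as [|h']; [assumption | exfalso].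
      assert (f (y t) <= f (y x + eps)).
      { destruct h' as [h' | <-]; [| lra].
        left. apply hf; [lra | lra | apply hy]. }
      rewrite heq in H. lra.
    - apply filter_forall. intros t. assert (ht := hy t). lra. }
  assert (dn : locally x (fun t => y x - eps < y t)).
  { destruct (Rle_lt_dec 0 (y x - eps)) as [h | h].
    - assert (k : 0 < f (y x - eps) - g x).
      { assert (f (y x) < f (y x - eps)) by (apply hf; lra). rewrite <- heq. lra. }
      apply (filter_imp (F := locally x) (fun t => Rabs (g t - g x) < f (y x - eps) - g x)).
      2: exact (proj1 (continuity_pt_locally _ _) (hg x) (mkposreal _ k)).
      intros t ht. apply Rabs_def2 in ht.
      destruct (Rlt_le_dec (y x - eps) (y t)) as [|h']; [assumption | exfalso].
      assert (f (y x - eps) <= f (y t)).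
      { destruct h' as [h' | ->]; [| lra].
        left. apply hf; [apply hy | lra | lra]. }
      rewrite heq in H. lra.
    - apply filter_forall. intros t. assert (ht := hy t). lra. }
  apply (filter_imp (F := locally x) (fun t => y t < y x + eps /\ y x - eps < y t)).
  2: now apply filter_and.
  intros t [h1 h2]. apply Rabs_def1; lra.
Qed.

Lemma locally_open_interval (a b x : R) : a < x < b -> locally x (fun t => a < t < b).
Proof.
  intros h. apply (filter_and (F := locally x)).
  - now apply (open_gt a x).
  - now apply (open_lt b x).
Qed.

(** * Slopes of convex functions *)

Lemma convex_three_points (a b : R) (q : R -> R) (x y z : R) :
  convex_on_interval a b q -> a < x -> x < y -> y < z -> z < b ->
  (q y - q x) * (z - y) <= (q z - q y) * (y - x).
Proof.
  intros hq hx hxy hyz hz.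
  assert (ht : 0 <= (y - x) / (z - x) <= 1).
  { split.
    - apply Rmult_le_pos; [lra | left; apply Rinv_0_lt_compat; lra].
    - apply (Rmult_le_reg_r (z - x)); [lra |].
      unfold Rdiv. rewrite Rmult_assoc, Rinv_l; lra. }
  assert (h := hq x z ((y - x) / (z - x)) ltac:(lra) ltac:(lra) ht).
  replace ((1 - (y - x) / (z - x)) * x + (y - x) / (z - x) * z) with y in h
    by (field; lra).
  apply (Rmult_le_compat_l (z - x)) in h; [| lra].
  replace ((z - x) * ((1 - (y - x) / (z - x)) * q x + (y - x) / (z - x) * q z))
    with ((z - y) * q x + (y - x) * q z) in h by (field; lra).
  lra.
Qed.

Lemma convex_chord_slopes (a b : R) (q : R -> R) (x y z w : R) :
  convex_on_interval a b q -> a < x -> x < y -> y <= z -> z < w -> w < b ->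
  (q y - q x) * (w - z) <= (q w - q z) * (y - x).
Proof.
  intros hq hx hxy [hyz | <-] hzw hw.
  - assert (h1 := convex_three_points a b q x y z hq hx hxy hyz ltac:(lra)).
    assert (h2 := convex_three_points a b q y z w hq ltac:(lra) hyz hzw hw).
    apply (Rmult_le_reg_l (z - y)); [lra |].
    apply (Rmult_le_compat_r (w - z)) in h1; [| lra].
    apply (Rmult_le_compat_r (y - x)) in h2; [| lra].
    lra.
  - now apply (convex_three_points a b).
Qed.

Lemma convex_increasing_after (a b : R) (q : R -> R) (x y z : R) :
  convex_on_interval a b q -> a < x -> x < y -> y <= z -> z < b ->
  q x < q y -> q y <= q z.
Proof.
  intros hq hx hxy [hyz | <-] hz h; [| lra].
  assert (k := convex_three_points a b q x y z hq hx hxy hyz hz). nra.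
Qed.

Lemma convex_le_of_endpoint (a b : R) (q : R -> R) (x y z : R) :
  convex_on_interval a b q -> a < x -> x < y -> y <= z -> z < b ->
  q x <= q z -> q y <= q z.
Proof.
  intros hq hx hxy hyz hz h.
  destruct (Rle_lt_dec (q y) (q z)) as [| k]; [assumption |].
  apply (convex_increasing_after a b q x y z); lra || assumption.
Qed.

Lemma convex_reflect (a b : R) (q : R -> R) :
  convex_on_interval (- a) b q -> convex_on_interval (- b) a (fun s => q (- s)).
Proof.
  intros hq x y t hx hy ht.
  replace (- ((1 - t) * x + t * y)) with ((1 - t) * - x + t * - y) by ring.
  apply hq; lra.
Qed.

(** * The wave decreases on both sides of its maximum point *)

(** One side of the ground state, as a function of the distance to its maximum
    point; [d] is its derivative. *)
Record half_wave (b : R) (q u d : R -> R) : Prop := {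
  hw_length : 0 < b;
  hw_continuity : continuity u;
  hw_top : u 0 = 1;
  hw_slope_top : d 0 = 0;
  hw_end : u b = 0;
  hw_pos : forall y, 0 <= y < b -> 0 < u y;
  hw_derive : forall y, 0 <= y < b -> is_derive u y (d y);
  hw_equation : forall y, 0 <= y < b -> is_derive d y (q y * u y)
}.

(** Where [q >= 0] the function is convex: once it is not decreasing there it can
    never come down to [0]. *)
Lemma half_wave_slope_neg_of_nonneg (b : R) (q u d : R -> R) (c : R) :
  half_wave b q u d -> 0 <= c < b ->
  (forall y, c < y < b -> 0 <= q y) -> d c < 0.
Proof.
  intros H hc hq. destruct (Rlt_le_dec (d c) 0) as [| hd]; [assumption | exfalso].
  assert (hdy : forall y, c < y < b -> 0 <= d y).
  { intros y hy. apply Rle_trans with (1 := hd).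
    apply (derive_nonneg_le d (fun y => q y * u y)); [lra | | |].
    - intros x hx. eapply is_derive_continuity, (hw_equation _ _ _ _ H). lra.
    - intros x hx. apply (hw_equation _ _ _ _ H). lra.
    - intros x hx. apply Rmult_le_pos; [apply hq; lra |].
      left; apply (hw_pos _ _ _ _ H); lra. }
  assert (h : u c <= u b).
  { apply (derive_nonneg_le u d); [lra | | | exact hdy].
    - intros x _. apply (hw_continuity _ _ _ _ H).
    - intros x hx. apply (hw_derive _ _ _ _ H). lra. }
  assert (k := hw_pos _ _ _ _ H c hc).
  rewrite (hw_end _ _ _ _ H) in h. lra.
Qed.

(** If [q] were nonnegative at the maximum point, convexity would make it
    nonnegative on one whole side of it, and the function would not decrease
    there. *)
Lemma potential_neg_at_top (a b : R) (q ul dl ur dr : R -> R) :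
  half_wave a (fun s => q (- s)) ul dl -> half_wave b q ur dr ->
  convex_on_interval (- a) b q -> q 0 < 0.
Proof.
  intros Hl Hr hq. destruct (Rlt_le_dec (q 0) 0) as [| h0]; [assumption | exfalso].
  assert (ha := hw_length _ _ _ _ Hl). assert (hb := hw_length _ _ _ _ Hr).
  assert (nr : ~ forall y, 0 < y < b -> 0 <= q y).
  { intros h. assert (k := half_wave_slope_neg_of_nonneg _ _ _ _ 0 Hr ltac:(lra) h).
    rewrite (hw_slope_top _ _ _ _ Hr) in k. lra. }
  assert (nl : ~ forall y, 0 < y < a -> 0 <= q (- y)).
  { intros h. assert (k := half_wave_slope_neg_of_nonneg _ _ _ _ 0 Hl ltac:(lra) h).
    rewrite (hw_slope_top _ _ _ _ Hl) in k. lra. }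
  apply nr. intros y hy. destruct (Rle_lt_dec 0 (q y)) as [| hqy]; [assumption | exfalso].
  apply nl. intros x hx.
  assert (k := convex_three_points _ _ q (- x) 0 y hq ltac:(lra) ltac:(lra) ltac:(lra) ltac:(lra)).
  nra.
Qed.

Lemma half_wave_slope_neg (a b : R) (q u d : R -> R) (y : R) :
  half_wave b q u d -> convex_on_interval (- a) b q -> 0 < a -> q 0 < 0 ->
  0 < y < b -> d y < 0.
Proof.
  intros H hq ha h0 hy.
  destruct (Rlt_le_dec (q y) 0) as [hqy | hqy].
  - rewrite <- (hw_slope_top _ _ _ _ H).
    apply (derive_neg_lt d (fun y => q y * u y)); [lra | | |].
    + intros x hx. eapply is_derive_continuity, (hw_equation _ _ _ _ H). lra.
    + intros x hx. apply (hw_equation _ _ _ _ H). lra.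
    + intros x hx. assert (k := hw_pos _ _ _ _ H x ltac:(lra)).
      assert (q x < 0); [| nra].
      destruct (Rlt_le_dec (q x) 0) as [| hqx]; [assumption |].
      assert (m := convex_increasing_after _ _ q 0 x y hq ltac:(lra) ltac:(lra)
                     ltac:(lra) ltac:(lra) ltac:(lra)). lra.
  - apply (half_wave_slope_neg_of_nonneg b q u d y H); [lra |].
    intros x hx.
    assert (m := convex_increasing_after _ _ q 0 y x hq ltac:(lra) ltac:(lra)
                   ltac:(lra) ltac:(lra) ltac:(lra)). lra.
Qed.

(** * Parametrisation by the angle *)

(** The half wave in the angle [t = arccos u]: [y t] is the distance from the
    maximum point at which the value [cos t] is reached, and [p t] is the
    steepness there.  The equation [u'' = q u] becomes a first order system,
    which is singular at the top [t = 0]. *)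
Record level_curve (b : R) (q y p : R -> R) : Prop := {
  lc_start : y 0 = 0;
  lc_end : y (PI / 2) = b;
  lc_continuity : continuity y;
  lc_steepness_top : p 0 = 0;
  lc_continuity_top : continuity_pt p 0;
  lc_range : forall t, 0 < t < PI / 2 -> 0 < y t < b;
  lc_steep : forall t, 0 < t < PI / 2 -> 0 < p t;
  lc_derive : forall t, 0 < t < PI / 2 -> is_derive y t (sin t / p t);
  lc_energy : forall t, 0 < t < PI / 2 ->
    is_derive p t (- (sin t * cos t * q (y t)) / p t)
}.

Lemma half_wave_decreasing (b : R) (q u d : R -> R) :
  half_wave b q u d -> (forall y, 0 < y < b -> d y < 0) ->
  forall r s, 0 <= r -> r < s -> s <= b -> u s < u r.
Proof.
  intros H hd r s hr hrs hs.
  apply (derive_neg_lt u d); [assumption | | |].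
  - intros x _. apply (hw_continuity _ _ _ _ H).
  - intros x hx. apply (hw_derive _ _ _ _ H). lra.
  - intros x hx. apply hd. lra.
Qed.

Lemma half_wave_level_curve (b : R) (q u d : R -> R) :
  half_wave b q u d -> (forall y, 0 < y < b -> d y < 0) ->
  exists y p, level_curve b q y p /\ forall t, 0 < t < PI / 2 -> u (y t) = cos t.
Proof.
  intros H hd.
  assert (hb := hw_length _ _ _ _ H).
  assert (hpi := PI_RGT_0).
  assert (dec := half_wave_decreasing b q u d H hd).
  assert (hex : forall t, {x | 0 <= x <= b /\ u x = cos (clamp 0 (PI / 2) t)}).
  { intros t.
    destruct (IVT_gen u 0 b (cos (clamp 0 (PI / 2) t)) (hw_continuity _ _ _ _ H))
      as [x [hx ex]].
    - rewrite (hw_top _ _ _ _ H), (hw_end _ _ _ _ H).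
      rewrite Rmin_right, Rmax_left by lra.
      assert (hc := clamp_in 0 (PI / 2) t ltac:(lra)).
      split; [apply cos_ge_0; lra | apply COS_bound].
    - exists x. now rewrite Rmin_left, Rmax_right in hx by lra. }
  set (y := fun t => proj1_sig (hex t)).
  assert (hy : forall t, 0 <= y t <= b) by (intros t; exact (proj1 (proj2_sig (hex t)))).
  assert (ey : forall t, u (y t) = cos (clamp 0 (PI / 2) t))
    by (intros t; exact (proj2 (proj2_sig (hex t)))).
  clearbody y. clear hex.
  assert (inj : forall r s, 0 <= r <= b -> 0 <= s <= b -> u r = u s -> r = s).
  { intros r s hr hs e. destruct (Rtotal_order r s) as [l | [l | l]]; [| assumption |].
    - assert (k := dec r s ltac:(lra) l ltac:(lra)). lra.
    - assert (k := dec s r ltac:(lra) l ltac:(lra)). lra. }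
  assert (hcont : continuity y).
  { apply (decreasing_inverse_continuity u y (fun t => cos (clamp 0 (PI / 2) t)) b dec hy ey).
    intros t. apply (continuity_pt_comp (clamp 0 (PI / 2)) cos).
    - apply clamp_continuity.
    - apply continuity_cos. }
  assert (start : y 0 = 0).
  { apply inj; [apply hy | lra |].
    rewrite ey, clamp_id, cos_0, (hw_top _ _ _ _ H); lra. }
  assert (e : forall t, 0 < t < PI / 2 -> u (y t) = cos t).
  { intros t ht. rewrite ey, clamp_id; lra. }
  assert (range : forall t, 0 < t < PI / 2 -> 0 < y t < b).
  { intros t ht. assert (hyt := hy t). assert (et := e t ht).
    assert (c1 : 0 < cos t) by (apply cos_gt_0; lra).
    assert (c2 : cos t < cos 0) by (apply cos_decreasing_1; lra).
    rewrite cos_0 in c2.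
    split.
    - destruct hyt as [[| h] _]; [assumption |].
      rewrite <- h, (hw_top _ _ _ _ H) in et. lra.
    - destruct hyt as [_ [| h]]; [assumption |].
      rewrite h, (hw_end _ _ _ _ H) in et. lra. }
  assert (der : forall t, 0 < t < PI / 2 -> is_derive y t (sin t / - d (y t))).
  { intros t ht. assert (hr := range t ht). assert (hdt := hd _ hr).
    replace (sin t / - d (y t)) with (- sin t / d (y t)) by (field; lra).
    apply (is_derive_implicit u y cos).
    - apply (filter_imp (F := locally t) _ _ e). now apply locally_open_interval.
    - apply hcont.
    - apply (hw_derive _ _ _ _ H). lra.
    - lra.
    - apply is_derive_Reals, derivable_pt_lim_cos. }
  exists y, (fun t => - d (y t)). split; [| exact e].
  constructor; try assumption.
  - apply inj; [apply hy | lra |].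
    rewrite ey, clamp_id, cos_PI2, (hw_end _ _ _ _ H); lra.
  - rewrite start, (hw_slope_top _ _ _ _ H). ring.
  - apply continuity_pt_opp. apply (continuity_pt_comp y d); [apply hcont |].
    rewrite start. eapply is_derive_continuity, (hw_equation _ _ _ _ H). lra.
  - intros t ht. assert (k := hd _ (range t ht)). lra.
  - intros t ht. assert (hr := range t ht). assert (hdt := hd _ hr).
    assert (k := is_derive_comp d y t _ _ (hw_equation _ _ _ _ H (y t) ltac:(lra)) (der t ht)).
    apply (is_derive_opp (K := R_AbsRing) (V := R_NormedModule)) in k.
    replace (- (sin t * cos t * q (y t)) / - d (y t))
      with (opp (scal (sin t / - d (y t)) (q (y t) * u (y t)))); [exact k |].
    rewrite (e t ht). unfold opp, scal; simpl. unfold mult; simpl. field. lra.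
Qed.

Lemma sin_cos_pos (t : R) : 0 < t < PI / 2 -> 0 < sin t /\ 0 < cos t.
Proof.
  intros h. assert (hpi := PI_RGT_0).
  split; [apply sin_gt_0 | apply cos_gt_0]; lra.
Qed.

(** For constant [Q = k] the energy is exactly [- k sin^2]; this is the
    comparison with the sine profile. *)
Lemma energy_lower_bound (E Q : R -> R) (k t : R) :
  0 < t < PI / 2 ->
  E 0 = 0 -> continuity_pt E 0 ->
  (forall r, 0 < r <= t -> is_derive E r (- 2 * sin r * cos r * Q r)) ->
  (forall r, 0 < r < t -> Q r <= k) ->
  - k * sin t ^ 2 <= E t.
Proof.
  intros ht h0 hc hd hQ.
  set (F := fun r => E r + k * sin r ^ 2).
  assert (hs : forall r, is_derive (fun r => k * sin r ^ 2) r (2 * k * sin r * cos r)).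
  { intros r. auto_derive; [trivial | ring]. }
  assert (hF : F 0 <= F t).
  { apply (derive_nonneg_le F (fun r => - 2 * sin r * cos r * Q r + 2 * k * sin r * cos r));
      [lra | | |].
    - intros r [[hr | <-] hrt]; apply continuity_pt_plus.
      + eapply is_derive_continuity, hd. lra.
      + eapply is_derive_continuity, hs.
      + exact hc.
      + eapply is_derive_continuity, hs.
    - intros r hr. apply (is_derive_plus (K := R_AbsRing) (V := R_NormedModule) E).
      + apply hd. lra.
      + apply hs.
    - intros r hr. destruct (sin_cos_pos r ltac:(lra)) as [h1 h2].
      assert (h3 := hQ r hr). assert (h4 := Rmult_lt_0_compat _ _ h1 h2). nra. }
  unfold F in hF. rewrite h0, sin_0 in hF. lra.
Qed.

Section LevelCurve.

Context (b : R) (q y p : R -> R) (H : level_curve b q y p).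

Lemma level_curve_increasing (s t : R) : 0 <= s -> s < t -> t < PI / 2 -> y s < y t.
Proof.
  intros hs hst ht.
  destruct (mean_value y (fun r => sin r / p r) s t hst) as [c [hc e]].
  - intros r _. apply (lc_continuity _ _ _ _ H).
  - intros r hr. apply (lc_derive _ _ _ _ H). lra.
  - destruct (sin_cos_pos c ltac:(lra)) as [h1 _].
    assert (h2 := lc_steep _ _ _ _ H c ltac:(lra)).
    assert (h3 := Rdiv_lt_0_compat _ _ h1 h2). nra.
Qed.

Lemma level_curve_energy (t : R) : 0 < t < PI / 2 ->
  is_derive (fun r => p r ^ 2) t (- 2 * sin t * cos t * q (y t)).
Proof.
  intros ht. assert (hp := lc_steep _ _ _ _ H t ht).
  assert (hd := lc_energy _ _ _ _ H t ht).
  auto_derive; [now exists (- (sin t * cos t * q (y t)) / p t) |].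
  change (fun x => p x) with p.
  rewrite (is_derive_unique _ _ _ hd). field. lra.
Qed.

Lemma level_curve_energy_top :
  p 0 ^ 2 = 0 /\ continuity_pt (fun r => p r ^ 2) 0.
Proof.
  split; [rewrite (lc_steepness_top _ _ _ _ H); ring |].
  assert (hc := lc_continuity_top _ _ _ _ H).
  apply (continuity_pt_ext (fun r => p r * p r)); [intros r; ring |].
  now apply continuity_pt_mult.
Qed.

(** The speed [y' = sin / p] is constant for the sine profile, which satisfies
    [p^2 = - q sin^2]; hence the deviation from this identity in its derivative. *)
Lemma level_curve_speed_derive (t : R) : 0 < t < PI / 2 ->
  is_derive (fun r => sin r / p r) t (cos t * (p t ^ 2 + sin t ^ 2 * q (y t)) / p t ^ 3).
Proof.
  intros ht. assert (hp := lc_steep _ _ _ _ H t ht).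
  assert (hd := lc_energy _ _ _ _ H t ht).
  auto_derive; [split; [now exists (- (sin t * cos t * q (y t)) / p t) | split; [lra | trivial]] |].
  change (fun x => p x) with p.
  rewrite (is_derive_unique _ _ _ hd). field. lra.
Qed.

End LevelCurve.

(** * Convexity of the length of the level sets *)

(** The hypothesis on the right side breaks the symmetry: a convex [q] satisfies
    it either as it stands or after a reflection. *)
Record two_sided_wave (a b : R) (q y1 p1 y2 p2 : R -> R) : Prop := {
  tw_convex : convex_on_interval (- a) b q;
  tw_increasing : forall r s, 0 <= r -> r < s -> s < b -> q r <= q s;
  tw_left : level_curve a (fun s => q (- s)) y1 p1;
  tw_right : level_curve b q y2 p2
}.

Section TwoSidedWave.

Context (a b : R) (q y1 p1 y2 p2 : R -> R).
Context (H : two_sided_wave a b q y1 p1 y2 p2).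

Let hq := tw_convex _ _ _ _ _ _ _ H.
Let hinc := tw_increasing _ _ _ _ _ _ _ H.
Let H1 := tw_left _ _ _ _ _ _ _ H.
Let H2 := tw_right _ _ _ _ _ _ _ H.

Let range1 (t : R) (ht : 0 < t < PI / 2) : 0 < y1 t < a := lc_range _ _ _ _ H1 t ht.
Let range2 (t : R) (ht : 0 < t < PI / 2) : 0 < y2 t < b := lc_range _ _ _ _ H2 t ht.
Let steep1 (t : R) (ht : 0 < t < PI / 2) : 0 < p1 t := lc_steep _ _ _ _ H1 t ht.
Let steep2 (t : R) (ht : 0 < t < PI / 2) : 0 < p2 t := lc_steep _ _ _ _ H2 t ht.

(** As long as the left potential has not risen above its value at the top, the
    left side is the steeper one. *)
Lemma right_less_steep (t : R) :
  0 < t < PI / 2 -> (forall r, 0 < r < t -> q (- y1 r) <= q 0) -> p2 t <= p1 t.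
Proof.
  intros ht h.
  destruct (level_curve_energy_top _ _ _ _ H1) as [e1 c1].
  destruct (level_curve_energy_top _ _ _ _ H2) as [e2 c2].
  assert (k : - 0 * sin t ^ 2 <= p1 t ^ 2 - p2 t ^ 2).
  { apply (energy_lower_bound (fun r => p1 r ^ 2 - p2 r ^ 2)
             (fun r => q (- y1 r) - q (y2 r))); [assumption | lra | | |].
    - now apply continuity_pt_minus.
    - intros r hr.
      replace (- 2 * sin r * cos r * (q (- y1 r) - q (y2 r)))
        with (- 2 * sin r * cos r * q (- y1 r) - - 2 * sin r * cos r * q (y2 r)) by ring.
      apply (is_derive_minus (K := R_AbsRing) (V := R_NormedModule)
               (fun r => p1 r ^ 2) (fun r => p2 r ^ 2)).
      + apply (level_curve_energy _ _ _ _ H1). lra.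
      + apply (level_curve_energy _ _ _ _ H2). lra.
    - intros r hr. assert (k1 := h r hr). assert (k2 := range2 r ltac:(lra)).
      assert (k3 := hinc 0 (y2 r) ltac:(lra) ltac:(lra) ltac:(lra)). lra. }
  assert (s1 := steep1 t ht). assert (s2 := steep2 t ht). nra.
Qed.

(** When the left potential decreases outwards, the right side is less steep, so
    the right level point moves faster than the left one, through a region where
    the convex [q] has a larger slope. *)
Lemma potential_sum_increasing (s t : R) :
  0 < s -> s < t -> t < PI / 2 ->
  q (- y1 s) + q (y2 s) <= q (- y1 t) + q (y2 t).
Proof.
  intros hs hst ht.
  assert (i1 := level_curve_increasing _ _ _ _ H1 s t ltac:(lra) hst ht).
  assert (i2 := level_curve_increasing _ _ _ _ H2 s t ltac:(lra) hst ht).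
  assert (r1 := range1 s ltac:(lra)). assert (r2 := range2 s ltac:(lra)).
  assert (r1' := range1 t ltac:(lra)). assert (r2' := range2 t ltac:(lra)).
  assert (j := hinc (y2 s) (y2 t) ltac:(lra) i2 ltac:(lra)).
  destruct (Rle_lt_dec (q (- y1 s)) (q (- y1 t))) as [| hdec]; [lra |].
  assert (top : q (- y1 t) <= q 0).
  { assert (k := convex_increasing_after _ _ q (- y1 t) (- y1 s) 0 hq
                   ltac:(lra) ltac:(lra) ltac:(lra) ltac:(lra) hdec). lra. }
  assert (low : forall r, 0 < r < t -> q (- y1 r) <= q 0).
  { intros r hr. assert (i := level_curve_increasing _ _ _ _ H1 r t ltac:(lra) ltac:(lra) ht).
    assert (k := range1 r ltac:(lra)).
    apply (convex_le_of_endpoint (- a) b q (- y1 t)); lra || assumption. }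
  assert (faster : y2 s - y1 s <= y2 t - y1 t).
  { apply (derive_nonneg_le (fun r => y2 r - y1 r) (fun r => sin r / p2 r - sin r / p1 r));
      [lra | | |].
    - intros r _. apply continuity_pt_minus.
      + apply (lc_continuity _ _ _ _ H2).
      + apply (lc_continuity _ _ _ _ H1).
    - intros r hr. apply (is_derive_minus (K := R_AbsRing) (V := R_NormedModule) y2 y1).
      + apply (lc_derive _ _ _ _ H2). lra.
      + apply (lc_derive _ _ _ _ H1). lra.
    - intros r hr.
      assert (k := right_less_steep r ltac:(lra) (fun x hx => low x ltac:(lra))).
      assert (k2 := steep2 r ltac:(lra)).
      destruct (sin_cos_pos r ltac:(lra)) as [hsin _].
      assert (k3 := Rinv_le_contravar _ _ k2 k). unfold Rdiv. nra. }
  assert (k := convex_chord_slopes _ _ q (- y1 t) (- y1 s) (y2 s) (y2 t) hq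
                 ltac:(lra) ltac:(lra) ltac:(lra) i2 ltac:(lra)).
  nra.
Qed.

(** With [A_i = p_i^2 + sin^2 q_i], the comparison with the sine profile gives
    [A_2 >= 0] and [A_1 + A_2 >= 0].  Only [A_1] can be negative, and then the
    weight [p_2^-3] of [A_2] is the larger one. *)
Lemma speed_derivative_nonneg (t : R) : 0 < t < PI / 2 ->
  0 <= cos t * (p1 t ^ 2 + sin t ^ 2 * q (- y1 t)) / p1 t ^ 3
       + cos t * (p2 t ^ 2 + sin t ^ 2 * q (y2 t)) / p2 t ^ 3.
Proof.
  intros ht.
  destruct (level_curve_energy_top _ _ _ _ H1) as [e1 c1].
  destruct (level_curve_energy_top _ _ _ _ H2) as [e2 c2].
  assert (s1 := steep1 t ht). assert (s2 := steep2 t ht).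
  assert (r1 := range1 t ht). assert (r2 := range2 t ht).
  destruct (sin_cos_pos t ht) as [hsin hcos].
  assert (hA2 : - q (y2 t) * sin t ^ 2 <= p2 t ^ 2).
  { apply (energy_lower_bound (fun r => p2 r ^ 2) (fun r => q (y2 r)));
      try assumption.
    - intros r hr. apply (level_curve_energy _ _ _ _ H2). lra.
    - intros r hr. assert (k := range2 r ltac:(lra)).
      assert (i := level_curve_increasing _ _ _ _ H2 r t ltac:(lra) ltac:(lra) ltac:(lra)).
      apply hinc; lra. }
  assert (hA : - (q (- y1 t) + q (y2 t)) * sin t ^ 2 <= p1 t ^ 2 + p2 t ^ 2).
  { apply (energy_lower_bound (fun r => p1 r ^ 2 + p2 r ^ 2)
             (fun r => q (- y1 r) + q (y2 r))); [assumption | lra | | |].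
    - now apply continuity_pt_plus.
    - intros r hr.
      replace (- 2 * sin r * cos r * (q (- y1 r) + q (y2 r)))
        with (- 2 * sin r * cos r * q (- y1 r) + - 2 * sin r * cos r * q (y2 r)) by ring.
      apply (is_derive_plus (K := R_AbsRing) (V := R_NormedModule)
               (fun r => p1 r ^ 2) (fun r => p2 r ^ 2)).
      + apply (level_curve_energy _ _ _ _ H1). lra.
      + apply (level_curve_energy _ _ _ _ H2). lra.
    - intros r hr. apply potential_sum_increasing; lra. }
  set (A1 := p1 t ^ 2 + sin t ^ 2 * q (- y1 t)).
  set (A2 := p2 t ^ 2 + sin t ^ 2 * q (y2 t)).
  assert (hA2' : 0 <= A2) by (unfold A2; lra).
  assert (hA' : 0 <= A1 + A2) by (unfold A1, A2; lra).
  assert (i1 : 0 < / p1 t ^ 3) by (apply Rinv_0_lt_compat, pow_lt; assumption).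
  assert (i2 : 0 < / p2 t ^ 3) by (apply Rinv_0_lt_compat, pow_lt; assumption).
  assert (hsum : 0 <= A1 * / p1 t ^ 3 + A2 * / p2 t ^ 3).
  { destruct (Rle_lt_dec 0 A1) as [h | h].
    { assert (0 <= A1 * / p1 t ^ 3) by nra. nra. }
    (* [A1 < 0] says that [q] at the left level point is below the average of
       its values on the way there; as [q] is convex, it then stayed below its
       value at the top. *)
    assert (le : p2 t <= p1 t).
    { apply right_less_steep; [assumption |]. intros r hr.
      assert (k := range1 r ltac:(lra)).
      assert (i := level_curve_increasing _ _ _ _ H1 r t ltac:(lra) ltac:(lra) ltac:(lra)).
      apply (convex_le_of_endpoint (- a) b q (- y1 t)); try lra; [exact hq |].
      destruct (Rle_lt_dec (q (- y1 t)) (q 0)) as [| habove]; [assumption | exfalso].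
      assert (m : - q (- y1 t) * sin t ^ 2 <= p1 t ^ 2); [| unfold A1 in h; lra].
      apply (energy_lower_bound (fun r => p1 r ^ 2) (fun r => q (- y1 r)));
        try assumption.
      - intros x hx. apply (level_curve_energy _ _ _ _ H1). lra.
      - intros x hx. assert (kx := range1 x ltac:(lra)).
        assert (ix := level_curve_increasing _ _ _ _ H1 x t ltac:(lra) ltac:(lra) ltac:(lra)).
        destruct (Rle_lt_dec (q (- y1 x)) (q (- y1 t))) as [| hx']; [assumption |].
        assert (n := convex_increasing_after _ _ q (- y1 t) (- y1 x) 0 hq
                       ltac:(lra) ltac:(lra) ltac:(lra) ltac:(lra) hx'). lra. }
    assert (hcube : p2 t ^ 3 <= p1 t ^ 3) by (apply pow_incr; lra).
    assert (hinv := Rinv_le_contravar _ _ (pow_lt _ 3 s2) hcube).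
    nra. }
  replace (cos t * A1 / p1 t ^ 3 + cos t * A2 / p2 t ^ 3)
    with (cos t * (A1 * / p1 t ^ 3 + A2 * / p2 t ^ 3)) by (unfold Rdiv; ring).
  apply Rmult_le_pos; lra.
Qed.

(** The length of the level set at height [cos t] is convex in [t] and vanishes
    at [t = 0], hence lies below its chord over [0, pi/2]. *)
Lemma level_length_of_increasing (t : R) :
  0 < t < PI / 2 -> y1 t + y2 t <= 2 / PI * (a + b) * t.
Proof.
  intros ht.
  set (D := fun r => y1 r + y2 r). set (G := fun r => sin r / p1 r + sin r / p2 r).
  assert (cD : forall r, continuity_pt D r).
  { intros r. apply continuity_pt_plus.
    - apply (lc_continuity _ _ _ _ H1).
    - apply (lc_continuity _ _ _ _ H2). }
  assert (dD : forall r, 0 < r < PI / 2 -> is_derive D r (G r)).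
  { intros r hr. apply (is_derive_plus (K := R_AbsRing) (V := R_NormedModule) y1 y2).
    - now apply (lc_derive _ _ _ _ H1).
    - now apply (lc_derive _ _ _ _ H2). }
  assert (dG : forall r, 0 < r < PI / 2 -> is_derive G r
            (cos r * (p1 r ^ 2 + sin r ^ 2 * q (- y1 r)) / p1 r ^ 3
             + cos r * (p2 r ^ 2 + sin r ^ 2 * q (y2 r)) / p2 r ^ 3)).
  { intros r hr. apply (is_derive_plus (K := R_AbsRing) (V := R_NormedModule)
                          (fun r => sin r / p1 r) (fun r => sin r / p2 r)).
    - now apply (level_curve_speed_derive _ _ _ _ H1).
    - now apply (level_curve_speed_derive _ _ _ _ H2). }
  destruct (mean_value D G 0 t) as [c [hc ec]]; [lra | auto | intros; apply dD; lra |].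
  destruct (mean_value D G t (PI / 2)) as [e [he ee]]; [lra | auto | intros; apply dD; lra |].
  assert (mono : G c <= G e).
  { eapply (derive_nonneg_le G); [lra | | |].
    - intros r hr. eapply is_derive_continuity, dG. lra.
    - intros r hr. apply dG. lra.
    - intros r hr. apply speed_derivative_nonneg. lra. }
  assert (ec' : D t = G c * t).
  { assert (z : D 0 = 0).
    { unfold D. rewrite (lc_start _ _ _ _ H1), (lc_start _ _ _ _ H2). ring. }
    rewrite z in ec. lra. }
  assert (ee' : a + b - D t = G e * (PI / 2 - t)).
  { rewrite <- ee. unfold D.
    now rewrite (lc_end _ _ _ _ H1), (lc_end _ _ _ _ H2). }
  assert (chord : D t * (PI / 2) <= (a + b) * t).
  { assert (w : 0 <= t * (PI / 2 - t)) by (apply Rmult_le_pos; lra).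
    assert (k := Rmult_le_compat_r _ _ _ w mono).
    replace (G c * (t * (PI / 2 - t))) with (D t * (PI / 2 - t)) in k by (rewrite ec'; ring).
    replace (G e * (t * (PI / 2 - t))) with ((a + b - D t) * t) in k by (rewrite ee'; ring).
    lra. }
  apply (Rmult_le_reg_r (PI / 2)); [lra |].
  replace (2 / PI * (a + b) * t * (PI / 2)) with ((a + b) * t) by (field; lra).
  exact chord.
Qed.

End TwoSidedWave.

Lemma level_curve_ext (b : R) (q q' y p : R -> R) :
  (forall s, q s = q' s) -> level_curve b q y p -> level_curve b q' y p.
Proof.
  intros e H. destruct H. constructor; try assumption.
  intros t ht. rewrite <- e. auto.
Qed.

(** A convex potential that decreases somewhere to the right of [0] decreases
    everywhere to the left of it, and then the reflected potential increases to
    the right. *)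
Lemma level_length_bound (a b : R) (q y1 p1 y2 p2 : R -> R) (t : R) :
  convex_on_interval (- a) b q ->
  level_curve a (fun s => q (- s)) y1 p1 -> level_curve b q y2 p2 ->
  0 < t < PI / 2 -> y1 t + y2 t <= 2 / PI * (a + b) * t.
Proof.
  intros hq H1 H2 ht.
  assert (ha := lc_range _ _ _ _ H1 t ht). assert (hb := lc_range _ _ _ _ H2 t ht).
  destruct (classic (forall r s, 0 <= r -> r < s -> s < b -> q r <= q s))
    as [h | h].
  - apply (level_length_of_increasing a b q y1 p1 y2 p2); [now constructor | exact ht].
  - rewrite (Rplus_comm (y1 t)), (Rplus_comm a).
    apply (level_length_of_increasing b a (fun s => q (- s)) y2 p2 y1 p1); [| exact ht].
    constructor; [now apply convex_reflect | | | exact H1].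
    2: { apply (level_curve_ext b q); [| exact H2]. intros s. now rewrite Ropp_involutive. }
    intros r s hr hrs hs. destruct (Rle_lt_dec (q (- r)) (q (- s))) as [| k]; [assumption |].
    exfalso. apply h. intros x z hx hxz hz.
    assert (m := convex_chord_slopes _ _ q (- s) (- r) x z hq
                   ltac:(lra) ltac:(lra) ltac:(lra) hxz hz). nra.
Qed.

(** * The integral of the wave *)

(** The area between the wave and the height [cos t] has derivative
    [D t * sin t], which [level_length_bound] compares with [(2/pi) (a + b) t sin t];
    its primitive [(2/pi) (a + b) (sin t - t cos t)] equals [(2/pi) (a + b)] at
    [t = pi/2].  Here [D] is the length of the level set and [V] any primitive of
    the wave. *)
Lemma two_half_waves_integral (a b : R) (q V ul dl ur dr : R -> R) :
  convex_on_interval (- a) b q ->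
  half_wave a (fun s => q (- s)) ul dl -> half_wave b q ur dr ->
  (forall s, is_derive V (- s) (ul s)) -> (forall s, is_derive V s (ur s)) ->
  V b - V (- a) <= 2 / PI * (a + b).
Proof.
  intros hq Hl Hr hVl hVr. assert (hpi := PI_RGT_0).
  assert (ha := hw_length _ _ _ _ Hl). assert (hb := hw_length _ _ _ _ Hr).
  assert (q0 := potential_neg_at_top a b q ul dl ur dr Hl Hr hq).
  destruct (half_wave_level_curve a _ ul dl Hl) as [y1 [p1 [H1 e1]]].
  { intros y hy. apply (half_wave_slope_neg b a (fun s => q (- s)) ul dl); try assumption.
    - now apply convex_reflect.
    - now rewrite Ropp_0. }
  destruct (half_wave_level_curve b _ ur dr Hr) as [y2 [p2 [H2 e2]]].
  { intros y hy. now apply (half_wave_slope_neg a b q ur dr). }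
  set (c := 2 / PI * (a + b)).
  set (K := fun t => V (- y1 t) - V (y2 t) + (y1 t + y2 t) * cos t + c * (sin t - t * cos t)).
  assert (dK : forall t, 0 < t < PI / 2 ->
            is_derive K t (sin t * (c * t - (y1 t + y2 t)))).
  { intros t ht. assert (d1 := lc_derive _ _ _ _ H1 t ht).
    assert (d2 := lc_derive _ _ _ _ H2 t ht).
    unfold K. auto_derive.
    - repeat split; eexists; first [eassumption | apply hVl | apply hVr].
    - change (fun x => V x) with V. change (fun x => y1 x) with y1.
      change (fun x => y2 x) with y2.
      rewrite (is_derive_unique _ _ _ d1), (is_derive_unique _ _ _ d2).
      rewrite (is_derive_unique _ _ _ (hVl (y1 t))), (is_derive_unique _ _ _ (hVr (y2 t))).
      rewrite (e1 t ht), (e2 t ht). ring. }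
  assert (cV : continuity V) by (intros x; eapply is_derive_continuity, hVr).
  assert (c1 := lc_continuity _ _ _ _ H1). assert (c2 := lc_continuity _ _ _ _ H2).
  assert (hK : K 0 <= K (PI / 2)).
  { apply (derive_nonneg_le K (fun t => sin t * (c * t - (y1 t + y2 t)))); [lra | | exact dK |].
    - intros t _. unfold K.
      assert (i1 : continuity_pt (fun t => V (- y1 t)) t).
      { apply (continuity_pt_comp (fun t => - y1 t) V); [| apply cV].
        apply continuity_pt_opp, c1. }
      assert (i2 : continuity_pt (fun t => V (y2 t)) t).
      { apply (continuity_pt_comp y2 V); [apply c2 | apply cV]. }
      assert (i3 : continuity_pt (fun t => c * (sin t - t * cos t)) t).
      { eapply is_derive_continuity. auto_derive; [trivial | reflexivity]. }
      apply (continuity_pt_plus (fun t => V (- y1 t) - V (y2 t) + (y1 t + y2 t) * cos t));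
        [| exact i3].
      apply (continuity_pt_plus (fun t => V (- y1 t) - V (y2 t))).
      + now apply (continuity_pt_minus (fun t => V (- y1 t))).
      + apply (continuity_pt_mult (fun t => y1 t + y2 t) cos); [| apply continuity_cos].
        apply (continuity_pt_plus y1 y2); [apply c1 | apply c2].
    - intros t ht. destruct (sin_cos_pos t ht) as [hs _].
      assert (k := level_length_bound a b q y1 p1 y2 p2 t hq H1 H2 ht).
      apply Rmult_le_pos; [lra | unfold c; lra]. }
  unfold K in hK.
  rewrite (lc_start _ _ _ _ H1), (lc_start _ _ _ _ H2), (lc_end _ _ _ _ H1),
    (lc_end _ _ _ _ H2), sin_0, cos_0, sin_PI2, cos_PI2, Ropp_0 in hK.
  lra.
Qed.

Lemma is_derive_translate (f : R -> R) (m s l : R) :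
  is_derive f (m + s) l -> is_derive (fun s => f (m + s)) s l.
Proof.
  intros k. auto_derive; [now exists l |].
  change (fun x => f x) with f. rewrite (is_derive_unique _ _ _ k). ring.
Qed.

Lemma is_derive_reflect (f : R -> R) (m s l : R) :
  is_derive f (m - s) l -> is_derive (fun s => f (m - s)) s (- l).
Proof.
  intros k. auto_derive; [now exists l |].
  change (fun x => f x) with f. change (m + - s) with (m - s).
  rewrite (is_derive_unique _ _ _ k). ring.
Qed.

Theorem proposition3 (alpha beta : R) (hab : alpha < beta)
    (W : R -> R) (hW : convex_on_interval alpha beta W)
    (mu1 : R) (hmu : first_dirichlet_eigenvalue alpha beta W mu1)
    (v1 : R -> R) (hsol : dirichlet_solution alpha beta W mu1 v1)
    (hpos : forall s : R, alpha < s < beta -> 0 < v1 s)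
    (hnonneg : forall s : R, alpha <= s <= beta -> 0 <= v1 s)
    (hmax : is_max_on alpha beta v1 1) :
  RInt v1 alpha beta <= 2 / PI * (beta - alpha).
Proof.
  destruct hsol as [hcont [hode [hva hvb]]].
  destruct hmax as [[m [hm vm]] hle].
  assert (hin : alpha < m < beta).
  { destruct hm as [[h1 | <-] [h2 | ->]]; lra. }
  set (w := fun s => v1 (clamp alpha beta s)).
  assert (cw : continuity w) by (apply continuous_on_clamp; [lra | exact hcont]).
  assert (ew : forall s, alpha <= s <= beta -> w s = v1 s).
  { intros s hs. unfold w. now rewrite clamp_id. }
  assert (dw : forall s, alpha < s < beta -> is_derive w s (Derive v1 s)).
  { intros s hs. apply (is_derive_ext_loc v1).
    - apply (filter_imp (F := locally s) (fun t => alpha < t < beta)).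
      + intros t ht. symmetry. apply ew. lra.
      + now apply locally_open_interval.
    - apply Derive_correct. now apply hode. }
  assert (ddw : forall s, alpha < s < beta -> is_derive (Derive v1) s ((W s - mu1) * w s)).
  { intros s hs. destruct (hode s hs) as [_ [hex heq]].
    rewrite ew by lra. replace ((W s - mu1) * v1 s) with (Derive_n v1 2 s) by lra.
    exact (Derive_correct (Derive v1) s hex). }
  assert (dm : Derive v1 m = 0).
  { destruct (hode m hin) as [hex _]. apply ex_derive_Reals_0 in hex.
    rewrite <- (Derive_Reals v1 m hex).
    apply (deriv_maximum v1 alpha beta); [lra | lra |].
    intros x h1 h2. rewrite vm. apply hle. lra. }
  set (V := fun s => RInt w alpha (m + s)).
  assert (dV : forall s, is_derive V s (w (m + s))).
  { intros s. unfold V.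
    apply is_derive_translate, (is_derive_RInt w (RInt w alpha) alpha).
    - apply filter_forall. intros t. apply (RInt_correct (V := R_CompleteNormedModule)).
      apply (ex_RInt_continuous (V := R_CompleteNormedModule)).
      intros z _. apply continuity_pt_filterlim, cw.
    - apply continuity_pt_filterlim, cw. }
  set (q := fun s => W (m + s) - mu1).
  assert (cshift : forall e : R, continuity (fun s => w (m + e * s))).
  { intros e s. apply (continuity_pt_comp (fun s => m + e * s) w); [| apply cw].
    eapply is_derive_continuity. auto_derive; [trivial | reflexivity]. }
  assert (H := two_half_waves_integral (m - alpha) (beta - m) q V
    (fun s => w (m - s)) (fun s => - Derive v1 (m - s))
    (fun s => w (m + s)) (fun s => Derive v1 (m + s))).
  assert (E : V (beta - m) - V (- (m - alpha)) = RInt v1 alpha beta).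
  { unfold V. replace (m + - (m - alpha)) with alpha by ring.
    replace (m + (beta - m)) with beta by ring.
    rewrite RInt_point. unfold zero; simpl. rewrite Rminus_0_r.
    apply RInt_ext. intros x hx. rewrite Rmin_left, Rmax_right in hx by lra.
    apply ew. lra. }
  rewrite E in H. replace (m - alpha + (beta - m)) with (beta - alpha) in H by ring.
  apply H; clear H E.
  - intros x y t hx hy ht. unfold q.
    assert (k := hW (m + x) (m + y) t ltac:(lra) ltac:(lra) ht).
    replace ((1 - t) * (m + x) + t * (m + y)) with (m + ((1 - t) * x + t * y)) in k by ring.
    lra.
  - constructor.
    + lra.
    + intros s. apply (continuity_pt_ext (fun s => w (m + -1 * s))); [| apply cshift].
      intros z. f_equal. ring.
    + rewrite Rminus_0_r, ew; [exact vm | lra].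
    + rewrite Rminus_0_r, dm. ring.
    + replace (m - (m - alpha)) with alpha by ring. rewrite ew; [exact hva | lra].
    + intros y hy. rewrite ew by lra. apply hpos. lra.
    + intros y hy. apply is_derive_reflect, dw. lra.
    + intros y hy. assert (k := ddw (m - y) ltac:(lra)).
      apply is_derive_reflect, (is_derive_opp (K := R_AbsRing) (V := R_NormedModule)) in k.
      replace (q (- y) * w (m - y)) with (opp (- ((W (m - y) - mu1) * w (m - y)))).
      * exact k.
      * unfold q, opp; simpl. change (m + - y) with (m - y). ring.
  - constructor.
    + lra.
    + intros s. apply (continuity_pt_ext (fun s => w (m + 1 * s))); [| apply cshift].
      intros z. f_equal. ring.
    + rewrite Rplus_0_r, ew; [exact vm | lra].
    + now rewrite Rplus_0_r, dm.
    + replace (m + (beta - m)) with beta by ring. rewrite ew; [exact hvb | lra].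
    + intros y hy. rewrite ew by lra. apply hpos. lra.
    + intros y hy. apply is_derive_translate, dw. lra.
    + intros y hy. apply is_derive_translate, ddw. lra.
  - intros s. exact (dV (- s)).
  - exact dV.
Qed.
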